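(* Let $\Lambda_f$ be a uniformly random numerical semigroup with Frobenius number $f$, and $g(\Lambda_f)$ its genus. There are constants $\gamma_0$ and $\gamma_1$ such that, as $f \to \infty$, $\mathbb{E}[g(\Lambda_f)] - \frac{3f}{4}$ converges to $\gamma_0$ along even $f$ and to $\gamma_1$ along odd $f$.
   Context: A numerical semigroup is a subset $\Lambda \subseteq \mathbb{N}_0$ containing $0$, closed under addition, with finite complement. Its genus is $g(\Lambda) = \#(\mathbb{N}_0 \setminus \Lambda)$, its conductor is the least $c$ with $c + \mathbb{N}_0 \subseteq \Lambda$, and its Frobenius number is the conductor minus $1$. *)

(* Defs.v *)
From mathcomp Require Import all_boot all_order all_algebra.
From mathcomp Require Import all_classical all_reals all_analysis.
Set Implicit Arguments. Unset Strict Implicit. Unset Printing Implicit Defensive.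
Import Order.TTheory GRing.Theory Num.Theory.

Definition numerical_semigroup (L : nat -> Prop) : Prop :=
  [/\ L 0%N, (forall m n, L m -> L n -> L (m + n)%N)
    & exists N, forall n, (N <= n)%N -> L n].

Definition frobenius_number (L : nat -> Prop) (f : nat) : Prop :=
  ~ L f /\ forall n, (f < n)%N -> L n.

(* Every subset L of N_0 containing all n > f is determined by L ∩ [0, f];
   we encode it by A : {set 'I_f.+1}. *)
Definition lam (f : nat) (A : {set 'I_f.+1}) (n : nat) : Prop :=
  (n <= f)%N -> (inord n : 'I_f.+1) \in A.

Definition NSF (f : nat) : {set {set 'I_f.+1}} :=
  [set A | `[< numerical_semigroup (lam A) /\ frobenius_number (lam A) f >] ].

(* Genus of L with Frobenius number f: number of gaps; all gaps are <= f. *)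
Definition genus_frob (f : nat) (L : nat -> Prop) : nat :=
  count (fun n => ~~ `[< L n >]) (iota 0 f.+1).

Definition expected_genus (R : realType) (f : nat) : R :=
  ((\sum_(A in NSF f) (genus_frob f (lam A))%:R) / (#|NSF f|)%:R)%R.

(* Main.v *)
Require Import Defs.
From mathcomp Require Import all_boot all_order all_algebra.
From mathcomp Require Import all_classical all_reals all_analysis.
From mathcomp Require Import zify ring lra.
Set Implicit Arguments. Unset Strict Implicit. Unset Printing Implicit Defensive.
Import Order.TTheory GRing.Theory Num.Theory.
Import numFieldNormedType.Exports.

(** Let C_D(f), below [NSFD f D], be the set of semigroups with Frobenius number f all
    of whose positive elements x satisfy f < 2x + D.

    For f >= 3D the only sums that matter in C_D(f) are sums of two elements close to
    f/2, and they fall close to f. Inserting one gap position below f/2 and one free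
    position between the two ranges is therefore a bijection from C_D(f) x bool to
    C_D(f+2), under which the sums over C_D(f) of 1 and of (genus - 3f/4) are exactly
    doubled. Divided by 2^(f/2), both are thus eventually constant along each parity.

    It remains to bound C_(d+1)(f) \ C_d(f), the semigroups of multiplicity m with
    f = 2m + d, by 2^(f/2) times a summable function of d. Write f = qm + r. The Kunz
    coordinate of a residue a takes l_a = q + [a < r] values, the sum of the l_a is f,
    and m + t in the semigroup, with t > 0 minimal, forces k_(a+t) <= k_a + 1.
    A transfer-matrix estimate along the progressions of step t shows that each residue
    with l_a = 3, 4, 5 contributes a factor at most sqrt(8/9) 2^(l_a/2); residues with
    l_a = 2 contribute exactly 2, and for q >= 5 the crude count l_a is good enough. *)

(** * Counting words with a transfer operator *)

Section Words.
Variables (R : realType) (t n : nat) (l : nat -> nat).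
Local Open Scope ring_scope.

(* Words are stored last letter first, so [nth 0 s t.-1] is the letter [t] places back. *)
Definition next_letter (j : nat) (s : seq nat) : seq nat :=
  [seq k <- iota 0 (l j) | (j < n)%N ==>
     (if (j < t)%N then (k == 0%N) == (j == 0%N) else (k <= (nth 0%N s t.-1).+1)%N)].

Fixpoint words (j : nat) : seq (seq nat) :=
  if j is i.+1 then [seq k :: s | s <- words i, k <- next_letter i s]
  else [:: [::]].

(* A vector on which the transfer operator [k' <= k + 1], restricted to [l] letters,
   contracts by [letter_bound l] below; it is switched off on the last [t] positions,
   so that the total weight of the full words is their number. *)
Definition letter_weight (k : nat) : R := if k == 0%N then 4/5 else 6/5.

Definition pos_weight (b k : nat) : R :=
  if (b + t < n)%N then letter_weight k else 1.

Definition word_weight (j : nat) (s : seq nat) : R :=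
  \prod_(b < t | (b < j)%N) pos_weight (j - b.+1) (nth 0%N s b).

(** The value 8/3 is (4/5 + 6/5 + 6/5) / (6/5), what three letters cost after a nonzero one. The
    slope 11/10 is large enough for the four nonzero letters of weight 6/5 in an initial position
    with [k = 5], and small enough for [letter_bound_sq] at [k = 4]. *)
Definition letter_bound (k : nat) : R := 8/3 + 11/10 * (k%:R - 3).

Definition pos_bound (j : nat) : R :=
  if (j < n)%N then letter_bound (l j) else (l j)%:R.

Lemma pos_weight_ge0 b k : 0 <= pos_weight b k.
Proof. by rewrite /pos_weight /letter_weight; do 2?case: ifP => _; lra. Qed.

Lemma sum_filter_le (F : nat -> R) (P : pred nat) (s : seq nat) :
  (forall k, 0 <= F k) -> \sum_(k <- [seq k <- s | P k]) F k <= \sum_(k <- s) F k.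
Proof.
move=> F0; rewrite big_filter [leRHS](bigID P) /= lerDl.
exact: sumr_ge0.
Qed.

Hypothesis t_gt0 : (0 < t)%N.
Hypothesis l_small : forall j, (j < n)%N -> (3 <= l j <= 5)%N.


Lemma sum_next_letter_start j s : (j < t)%N ->
  \sum_(k <- next_letter j s) pos_weight j k <= pos_bound j.
Proof.
move=> jt; rewrite /next_letter /pos_bound jt.
have [jn|nj] := ltnP j n; last first.
  rewrite /= filter_predT /pos_weight ltnNge (leq_trans nj (leq_addr _ _)) /=.
  by rewrite big_const_seq count_predT size_iota iter_addr_0.
have := l_small jn; rewrite /letter_bound /pos_weight /letter_weight.
case: (l j) => [|[|[|[|[|[|k]]]]]] //= _; case: j {jt jn} => [|j];
  rewrite ?(eqxx, big_cons, big_nil) /=; case: ifP => _; lra.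
Qed.

Lemma sum_next_letter j s : (t <= j)%N ->
  \sum_(k <- next_letter j s) pos_weight j k <=
    pos_bound j * pos_weight (j - t) (nth 0%N s t.-1).
Proof.
move=> tj; rewrite /next_letter /pos_bound [(j < t)%N]ltnNge tj /=.
rewrite [X in _ * X]/pos_weight subnK //.
have [jn|nj] := ltnP j n; last first.
  rewrite /= filter_predT /pos_weight ltnNge (leq_trans nj (leq_addr _ _)) /=.
  by rewrite big_const_seq count_predT size_iota iter_addr_0 mulr1.
case: (nth _ _ _) => [|a].
  have := l_small jn; rewrite /letter_bound /pos_weight /letter_weight /=.
  by case: (l j) => [|[|[|[|[|[|k]]]]]] //= _;
    rewrite ?(eqxx, big_cons, big_nil) /=; case: ifP => _; lra.
(* After a nonzero letter the weight 6/5 pays for all [l j] letters, so the constraint is dropped;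
   only a previous 0 uses it. *)
apply: le_trans (sum_filter_le _ _ (pos_weight_ge0 _)) _.
have := l_small jn; rewrite /letter_bound /pos_weight /letter_weight /=.
by case: (l j) => [|[|[|[|[|[|k]]]]]] //= _;
  rewrite ?(eqxx, big_cons, big_nil) /=; case: ifP => _; lra.
Qed.

Lemma pos_bound_ge0 j : 0 <= pos_bound j.
Proof.
rewrite /pos_bound; case: ifP => // /l_small /andP[]; rewrite -(ler_nat R) => h _.
by rewrite /letter_bound; lra.
Qed.

(** Appending a letter pushes the one [t] places back out of the window of [word_weight]; its factor
    is exactly what [sum_next_letter] spends on the new letter. *)
Lemma sum_word_weight j :
  \sum_(s <- words j) word_weight j s <= \prod_(i < j) pos_bound i.
Proof.
elim: j => [|j IH].
  rewrite big_ord0 /= big_seq1 /word_weight big_pred0 // => b.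
rewrite big_ord_recr /= big_allpairs_dep /=.
apply: le_trans (_ : (\sum_(s <- words j) word_weight j s) * pos_bound j <= _); last first.
  by rewrite ler_wpM2r // pos_bound_ge0.
rewrite big_distrl /=; apply: ler_sum => s _.
move: t_gt0 => /prednK; set t' := t.-1 => tE.
have recl (F : nat -> R) u v : u.+1 = v -> \prod_(b < v | (b < j.+1)%N) F b =
    F 0%N * \prod_(b < u | (b < j)%N) F b.+1.
  by move=> <-; rewrite big_mkcond big_ord_recl [in RHS]big_mkcond.
have recr (F : nat -> R) u v : u.+1 = v -> \prod_(b < v | (b < j)%N) F b =
    (\prod_(b < u | (b < j)%N) F b) * (if (v <= j)%N then F u else 1).
  by move=> <-; rewrite big_mkcond big_ord_recr /= -big_mkcond.
have wE k : word_weight j.+1 (k :: s) =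
    pos_weight j k * \prod_(b < t' | (b < j)%N) pos_weight (j - b.+1) (nth 0%N s b).
  rewrite /word_weight.
  rewrite (recl (fun b => pos_weight (j.+1 - b.+1) (nth 0%N (k :: s) b)) _ _ tE) /=.
  by rewrite subSS subn0.
under eq_bigr do rewrite wE.
rewrite -big_distrl /= [word_weight _ _]/word_weight.
rewrite [in leRHS](recr (fun b => pos_weight (j - b.+1) (nth 0%N s b)) _ _ tE) tE.
rewrite mulrC -mulrA ler_wpM2l ?prodr_ge0// => [b _|]; first exact: pos_weight_ge0.
case: leqP => tj; first by rewrite mulrC sum_next_letter.
by rewrite mul1r sum_next_letter_start.
Qed.

Lemma size_words j : (n <= j)%N -> (size (words j))%:R <= \prod_(i < j) pos_bound i :> R.
Proof.
move=> nj; apply: le_trans (sum_word_weight j).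
rewrite -sum1_size natr_sum; apply: ler_sum => s _.
rewrite /word_weight big1 // => b bj; rewrite /pos_weight.
by case: ifP => // h; case: b bj h => b bt /= bj h; lia.
Qed.

End Words.

(** * Boolean membership in the semigroup coded by [A] *)

Definition lamb (f : nat) (A : {set 'I_f.+1}) (x : nat) : bool :=
  (x <= f) ==> (inord x \in A).

Lemma lambP f (A : {set 'I_f.+1}) x : reflect (lam A x) (lamb A x).
Proof. exact: implyP. Qed.

Lemma lamb_ord f (A : {set 'I_f.+1}) (x : 'I_f.+1) : lamb A x = (x \in A).
Proof. by rewrite /lamb -ltnS ltn_ord inord_val. Qed.

Lemma lamb_gt f (A : {set 'I_f.+1}) x : f < x -> lamb A x.
Proof. by rewrite /lamb ltnNge => /negbTE ->. Qed.

Lemma NSFP f (A : {set 'I_f.+1}) :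
  reflect [/\ lamb A 0, forall x y, lamb A x -> lamb A y -> lamb A (x + y)
            & ~~ lamb A f] (A \in NSF f).
Proof.
rewrite inE; apply: (iffP idP) => [/asboolP[[L0 LD _] [Lf _]]|[L0 LD Lf]].
  split; [exact/lambP|move=> x y /lambP Lx /lambP Ly; apply/lambP; exact: LD|].
  exact/lambP.
apply/asboolP; split; split.
- exact/lambP.
- by move=> x y /lambP Lx /lambP Ly; apply/lambP; exact: LD.
- by exists f.+1 => x fx; apply/lambP/lamb_gt.
- exact/lambP.
- by move=> x fx; apply/lambP/lamb_gt.
Qed.

Arguments NSFP {f A}.
Arguments lambP {f A x}.

(** * Kunz coordinates as words *)

Section Kunz.
Variables (f m : nat) (l : nat -> nat) (A : {set 'I_f.+1}).

(* [kunz a + 1] is the Kunz coordinate of the residue [a], truncated at [l a]. *)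
Definition kunz (a : nat) : nat :=
  find (fun j => lamb A (j.+1 * m + a)) (iota 0 (l a).-1).

Hypotheses (A_NSF : A \in NSF f) (mA : lamb A m).

Lemma kunz_le a : kunz a <= (l a).-1.
Proof. by rewrite -[leqRHS](size_iota 0) find_size. Qed.

(** Since [m] is in the semigroup, each residue class is closed upwards, so the first hit found by
    [kunz] is a threshold. *)
Lemma lamb_kunz a i : i < (l a).-1 -> lamb A (i.+1 * m + a) = (kunz a <= i).
Proof.
move=> il; have [_ LD _] := NSFP A_NSF.
have up j d : lamb A (j.+1 * m + a) -> lamb A ((j + d).+1 * m + a).
  elim: d => [|d IH] H; first by rewrite addn0.
  have -> : ((j + d.+1).+1 * m + a = (j + d).+1 * m + a + m)%N by ring.
  exact: LD (IH H) mA.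
apply/idP/idP => [Li|ki].
  rewrite leqNgt; apply/negP => /(before_find 0).
  by rewrite nth_iota // add0n Li.
have hk : kunz a < size (iota 0 (l a).-1) by rewrite size_iota (leq_ltn_trans ki).
have := hk; rewrite -has_find => /(nth_find 0).
rewrite -/(kunz a) nth_iota ?(leq_ltn_trans ki) // add0n => /(up _ (i - kunz a)).
by rewrite subnKC.
Qed.

Fixpoint history (k : nat -> nat) (j : nat) : seq nat :=
  if j is i.+1 then k i :: history k i else [::].

Lemma nth_history k j b : b < j -> nth 0 (history k j) b = k (j - b.+1).
Proof.
elim: j b => // j IH [|b] /=; first by rewrite subSS subn0.
by move=> bj; rewrite IH // subSS.
Qed.

Lemma history_words t n k j :
  (forall i, i < j -> k i \in next_letter t n l i (history k i)) ->
  history k j \in words t n l j.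
Proof.
elim: j => [|j IH] H /=; first by rewrite inE.
apply/allpairsPdep; exists (history k j), (k j); split => //; last exact: H.
by apply: IH => i ij; apply: H; rewrite ltnS ltnW.
Qed.

Lemma history_inj k k' j : history k j = history k' j ->
  forall i, i < j -> k i = k' i.
Proof.
elim: j => // j IH /= [e h] i; rewrite ltnS leq_eqVlt => /orP[/eqP -> //|].
exact: IH h i.
Qed.

Lemma history_kunz_words n :
  (forall i, 2 <= l i) -> (forall i j, i <= j -> l j <= l i) ->
  exists2 t, 0 < t <= n.+1 & history kunz m \in words t n l m.
Proof.
move=> l2 lmono; have [_ LD _] := NSFP A_NSF.
(* [t] is the least positive residue below [n] with [m + t] in the semigroup. If there is none, the
   default of [find] gives [t = n], which leaves no recursive constraint; for [n = 0] it gives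
   [t = 1], hence the bound [n.+1]. *)
pose P a := kunz a.+1 == 0; pose t := (find P (iota 0 n.-1)).+1.
have tn : t <= n.-1.+1 by rewrite ltnS -[leqRHS](size_iota 0) find_size.
exists t; first by lia.
apply: history_words => i im; rewrite mem_filter mem_iota /= add0n.
have := kunz_le i; have := l2 i => l2i ki.
apply/andP; split; last by lia.
apply/implyP => i_n; case: (ltnP i t) => it.
  case: i => [|i] in im i_n it l2i ki *.
    rewrite eqxx eqb_id; have : kunz 0 <= 0; last by rewrite leqn0.
    by rewrite -lamb_kunz ?mul1n ?addn0 //; have := l2 0; lia.
  rewrite eqbF_neg /=; apply/negP => ki0.
  have := before_find 0 (it : i < find P (iota 0 n.-1)).
  by rewrite nth_iota /P ?ki0 //; lia.
have t0 : kunz t == 0.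
  have ht : find P (iota 0 n.-1) < size (iota 0 n.-1) by rewrite size_iota; lia.
  have := ht; rewrite -has_find => /(nth_find 0).
  rewrite nth_iota; last by move: ht; rewrite size_iota.
  by rewrite add0n.
have Lt : lamb A (m + t).
  by rewrite -[m]mul1n lamb_kunz ?(eqP t0) //; have := l2 t; lia.
rewrite nth_history /=; last by rewrite -[t.-1.+1]/t; lia.
rewrite -[(find P _)]/(t.-1) prednK //; set a := i - t.
have lai : l i <= l a by apply: lmono; rewrite leq_subr.
(* Unless truncation at [l i] already gives the bound, adding [m + t] to [(kunz a).+1 * m + a]
   produces an element in the class of [i] one coordinate higher. Monotonicity of [l] keeps [kunz a]
   below the truncation at [a]. *)
have [h|h] := ltnP (kunz a).+1 (l i).-1; last by lia.
rewrite -lamb_kunz //.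
have La : lamb A ((kunz a).+1 * m + a) by rewrite lamb_kunz //; lia.
have -> : (kunz a).+2 * m + i = (kunz a).+1 * m + a + (m + t).
  by rewrite -[in LHS](subnK it) -/a; ring.
exact: LD.
Qed.

End Kunz.

(** * Semigroups of given multiplicity, counted by words *)

Section Count.
Variables (R : realType) (f m q r n : nat).
Hypotheses (fE : f = q * m + r) (rm : r < m) (q2 : 2 <= q).
Local Notation l := (fun a => q + (a < r)).
Hypothesis l_small : forall j, j < n -> 3 <= l j <= 5.
Hypothesis nm : n <= m.

Lemma kunz_inj (A B : {set 'I_f.+1}) :
  A \in NSF f -> B \in NSF f -> lamb A m -> lamb B m ->
  (forall x, 0 < x < m -> ~~ lamb A x) -> (forall x, 0 < x < m -> ~~ lamb B x) ->
  (forall a, a < m -> kunz m l A a = kunz m l B a) -> A = B.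
Proof.
move=> AN BN mA mB Am Bm k_eq; apply/setP => x; rewrite -!lamb_ord.
have [A0 _ Af] := NSFP AN; have [B0 _ Bf] := NSFP BN.
have [->|x0] := posnP x; first by rewrite A0 B0.
have [xm|mx] := ltnP x m; first by rewrite !(negbTE (Am _ _)) ?(negbTE (Bm _ _)) // x0.
have xf : x <= f by rewrite -ltnS.
(* [f] is a gap of both; strictly below [f] the index [i] stays under the truncation [(l a).-1],
   also in the class of [r]. *)
have [->|xf'] := eqVneq (val x) f; first by rewrite (negbTE Af) (negbTE Bf).
have {xf xf'} xf : x < f by rewrite ltn_neqAle xf'.
have m0 : 0 < m by lia.
have xE := divn_eq x m; have am := ltn_pmod x m0; set a := x %% m in xE am.
have : 0 < x %/ m by rewrite divn_gt0.
case: (x %/ m) xE => // i xE _.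
have il : i < (l a).-1.
  move: xf; rewrite xE fE /=; case: (ltnP a r) => ar; nia.
by rewrite xE (@lamb_kunz _ _ l A AN mA a i il) (@lamb_kunz _ _ l B BN mB a i il) k_eq.
Qed.

(** The Kunz word determines the semigroup by [kunz_inj], and the step [t] takes at most [n.+1]
    values. *)
Lemma card_multiplicity (X : {set {set 'I_f.+1}}) :
  (forall A, A \in X -> [/\ A \in NSF f, lamb A m & forall x, 0 < x < m -> ~~ lamb A x]) ->
  ((#|X|)%:R <= n.+1%:R * \prod_(i < m) pos_bound R n l i :> R)%R.
Proof.
move=> XP.
pose all_words := flatten [seq words t n l m | t <- iota 1 n.+1].
have le_card : #|X| <= size all_words.
  rewrite cardE -(size_map (fun A => history (kunz m l A) m)).
  apply: uniq_leq_size.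
    rewrite map_inj_in_uniq ?enum_uniq // => A B; rewrite !mem_enum => AX BX h.
    have [AN mA Am] := XP _ AX; have [BN mB Bm] := XP _ BX.
    by apply: kunz_inj => // a; apply: history_inj h a.
  move=> s /mapP[A]; rewrite mem_enum => /XP[AN mA _] ->.
  have [i|i j ij|t tn h] := @history_kunz_words f m l A AN mA n; first by lia.
    by case: ltnP => jr; case: ltnP => ir //; lia.
  apply/flattenP; exists (words t n l m) => //; apply/mapP; exists t => //.
  by rewrite mem_iota; lia.
apply: (@le_trans _ _ (size all_words)%:R%R); first by rewrite ler_nat.
rewrite /all_words size_flatten /shape -map_comp sumnE big_map natr_sum.
rewrite big_seq; apply: (@le_trans _ _
  (\sum_(t <- iota 1 n.+1 | t \in iota 1 n.+1) \prod_(i < m) pos_bound R n l i)%R).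
  apply: ler_sum => t; rewrite mem_iota => /andP[t0 _].
  exact: size_words.
by rewrite -big_seq big_const_seq count_predT size_iota iter_addr_0 mulr_natl.
Qed.

End Count.

(** * Numerical estimates for one multiplicity *)

Lemma sum_ltn_ord (m r : nat) : r <= m -> \sum_(i < m) (i < r : nat) = r.
Proof.
move=> rm; rewrite -[RHS]card_ord -sum1_card (big_ord_widen m (fun=> 1)) //.
by rewrite [RHS]big_mkcond; apply: eq_bigr => i _; case: ifP.
Qed.

Lemma sum_chain_lengths (m q r : nat) : r <= m ->
  \sum_(i < m) (q + (i < r)) = q * m + r.
Proof.
by move=> rm; rewrite big_split /= sum_ltn_ord // sum_nat_const card_ord mulnC.
Qed.

Section Bounds.
Variable R : realType.
Local Open Scope ring_scope.

Lemma letter_bound_sq (k : nat) : (3 <= k <= 5)%N ->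
  letter_bound R k ^+ 2 <= 8/9 * 2 ^+ k.
Proof.
rewrite /letter_bound; case: k => [|[|[|[|[|[|k]]]]]] //= _; lra.
Qed.

(** The base is 2 * 97/100, slightly below 2. The inequality fails at [k = 4], hence the threshold
    [5 <= q] for the crude count. *)
Lemma sq_le_exp (k : nat) : (5 <= k)%N -> k%:R ^+ 2 <= (97/50) ^+ k :> R.
Proof.
elim: k => // k IH; rewrite leq_eqVlt => /orP[/eqP <-|]; first by lra.
rewrite ltnS => k5; have {}IH := IH k5.
have k5' : 5 <= k%:R :> R by rewrite ler_nat.
rewrite [leRHS]exprS -natr1.
apply: le_trans (_ : 97/50 * k%:R ^+ 2 <= _); last by rewrite ler_wpM2l //; lra.
nra.
Qed.

Lemma prod_if_ltn (c : R) (m n : nat) : (n <= m)%N ->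
  \prod_(i < m) (if (i < n)%N then c else 1) = c ^+ n.
Proof.
move=> nm; rewrite -[in RHS](sum_ltn_ord nm) -prodrXr.
by apply: eq_bigr => i _; case: ifP.
Qed.

Lemma prod_pos_bound_sq (m q r n : nat) (l := fun a => (q + (a < r))%N) :
  (r <= m)%N -> (n <= m)%N -> (forall j, (j < n)%N -> (3 <= l j <= 5)%N) ->
  (forall j, (n <= j < m)%N -> l j = 2%N) ->
  (\prod_(i < m) pos_bound R n l i) ^+ 2 <= (8/9) ^+ n * 2 ^+ (q * m + r).
Proof.
move=> rm nm l35 l2; rewrite -prodrXl -(sum_chain_lengths q rm) -prodrXr.
rewrite -(prod_if_ltn _ nm) -big_split /=; apply: ler_prod => i _.
rewrite exprn_even_ge0 //= /pos_bound; case: ltnP => ni.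
  exact: letter_bound_sq (l35 _ ni).
by rewrite /l in l2; rewrite /l l2 ?ni ?ltn_ord // mul1r; lra.
Qed.

Lemma prod_chain_lengths_sq (m q r : nat) (l := fun a => (q + (a < r))%N) :
  (r <= m)%N -> (5 <= q)%N ->
  (\prod_(i < m) pos_bound R 0 l i) ^+ 2 <= (97/50) ^+ (q * m + r).
Proof.
move=> rm q5; rewrite -prodrXl -(sum_chain_lengths q rm) -prodrXr.
apply: ler_prod => i _; rewrite exprn_even_ge0 //= /pos_bound /=.
by apply: sq_le_exp; rewrite /l (leq_trans q5) // leq_addr.
Qed.

Lemma card_multiplicity_sq (f m d : nat) (X : {set {set 'I_f.+1}}) :
  (0 < m)%N -> f = (2 * m + d)%N ->
  (forall A, A \in X -> [/\ A \in NSF f, lamb A m & forall x, (0 < x < m)%N -> ~~ lamb A x]) ->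
  (#|X|)%:R ^+ 2 <= d.+1%:R ^+ 2 * (97/100) ^+ d * 2 ^+ f :> R.
Proof.
move=> m0 fd XP; set q := (f %/ m)%N; set r := (f %% m)%N.
have fE : f = (q * m + r)%N := divn_eq f m.
have rm : (r < m)%N := ltn_pmod f m0.
have q2 : (2 <= q)%N by rewrite /q leq_divRL //; lia.
have combine (n : nat) (P B : R) : (n <= d)%N -> (#|X|)%:R <= n.+1%:R * P ->
    P ^+ 2 <= B * 2 ^+ f -> B <= (97/100) ^+ d ->
    (#|X|)%:R ^+ 2 <= d.+1%:R ^+ 2 * (97/100) ^+ d * 2 ^+ f :> R.
  move=> nd XnP PB Bd.
  apply: (@le_trans _ _ ((n.+1%:R * P) ^+ 2)).
    by apply: lerXn2r => //; rewrite nnegrE //; apply: le_trans XnP.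
  rewrite exprMn -mulrA ler_pM ?exprn_even_ge0 //.
    by rewrite lerXn2r ?nnegrE // ler_nat.
  by apply: le_trans PB _; rewrite ler_wpM2r // exprn_ge0.
have r97 : 0 <= (97/100 : R) <= 1 by apply/andP; split; lra.
have dec (c : R) i j : 0 <= c <= 1 -> (i <= j)%N -> c ^+ j <= c ^+ i.
  by move=> /andP[c0 c1] ij; apply: ler_wiXn2l.
(* [n = 0] drops every constraint and counts all words; [d <= f] then turns (97/100)^f into
   (97/100)^d. *)
have [q5|] := leqP 5 q.
  apply: (@combine 0 _ ((97/100) ^+ f)); rewrite //.
  - by apply: (@card_multiplicity R f m q r 0 fE rm q2) => //.
  - rewrite -exprMn [in leRHS]fE (_ : 97 / 100 * 2 = 97/50) //; last by lra.
    exact: prod_chain_lengths_sq (ltnW rm) q5.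
  - by apply: dec => //; lia.
(* For [q = 2] one has [r = d]: the first [d] residues have three letters and the others two. *)
have [q2'|q3 q5] := leqP q 2.
  have qE : q = 2%N by apply/eqP; rewrite eqn_leq q2' q2.
  have rd : r = d by lia.
  have rd' : (r <= d)%N by rewrite rd.
  move=> _; apply: (combine r _ ((8/9) ^+ r) rd').
  - apply: (@card_multiplicity R f m q r r fE rm q2) => //; last exact: ltnW.
    by move=> j ->; rewrite qE.
  - rewrite [in leRHS]fE; apply: prod_pos_bound_sq; [exact: ltnW|exact: ltnW| |].
      by move=> j ->; rewrite qE.
    by move=> j /andP[rj _]; rewrite ltnNge rj qE.
  - by rewrite rd; apply: lerXn2r; rewrite ?nnegrE; lra.
(* For [q] equal to 3 or 4 every residue has 3, 4 or 5 letters; [d < 3 * m] and 8/9 <= (97/100)^3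
   give the rate. *)
have md : (m <= d)%N by nia.
apply: (combine m _ ((8/9) ^+ m) md).
- apply: (@card_multiplicity R f m q r m fE rm q2) => //.
  by move=> j _; case: (j < r)%N; lia.
- rewrite [in leRHS]fE; apply: prod_pos_bound_sq; [exact: ltnW|by []| |].
    by move=> j _; case: (j < r)%N; lia.
  by move=> j; lia.
- apply: (@le_trans _ _ ((97/100) ^+ (3 * m))); last by apply: dec => //; nia.
  by rewrite exprM; apply: lerXn2r; rewrite ?nnegrE; lra.
Qed.

End Bounds.

(** * The classes C_D(f) and their differences *)

Definition NSFD (f D : nat) : {set {set 'I_f.+1}} :=
  [set A in NSF f | [forall x : 'I_f.+1, (x \in A) ==> (0 < x) ==> (f < 2 * x + D)]].

Lemma NSFDP f D (A : {set 'I_f.+1}) :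
  reflect (A \in NSF f /\ forall x, 0 < x -> lamb A x -> f < 2 * x + D)
          (A \in NSFD f D).
Proof.
rewrite [A \in NSFD _ _]inE; apply: (iffP andP) => -[AN H]; split => //.
  move=> x x0 Ax; have [fx|xf] := ltnP f x; first by lia.
  move: Ax; rewrite /lamb xf /= => Ax.
  by have /implyP/(_ Ax) := forallP H (inord x); rewrite inordK // x0.
apply/forallP => x; apply/implyP; rewrite -lamb_ord => Ax; apply/implyP => x0.
exact: H.
Qed.
Arguments NSFDP {f D A}.

Lemma NSFD_sub f D : NSFD f D \subset NSFD f D.+1.
Proof.
apply/fintype.subsetP => A /NSFDP[AN H]; apply/NSFDP; split => // x x0 Ax.
by rewrite addnS ltnS ltnW // H.
Qed.

Lemma NSFD_full f : NSFD f f.+1 = NSF f.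
Proof.
apply/setP => A; apply/NSFDP/idP => [[]//|AN]; split => // x _ _.
by rewrite addnS ltnS leq_addl.
Qed.

(** A member of the difference has a positive element x with 2x + d <= f < 2x + d + 1. This x is its
    multiplicity, and f = 2x + d makes it the same for all members. *)
Lemma card_NSFDS_sq (R : realType) f d :
  ((#|NSFD f d.+1 :\: NSFD f d|)%:R ^+ 2 <= d.+1%:R ^+ 2 * (97/100) ^+ d * 2 ^+ f :> R)%R.
Proof.
set X := _ :\: _.
have XP A : A \in X -> exists2 m, [/\ 0 < m & f = 2 * m + d] &
    [/\ A \in NSF f, lamb A m & forall x, 0 < x < m -> ~~ lamb A x].
  rewrite inE => /andP[nAd /NSFDP[AN H]].
  have : ~ (forall x, 0 < x -> lamb A x -> f < 2 * x + d).
    by move=> H'; move/NSFDP: nAd; apply.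
  move/existsNP => [m] /not_implyP[m0] /not_implyP[mA] /negP; rewrite -leqNgt => mf.
  have := H _ m0 mA => mf'; exists m; first by split => //; lia.
  split => // x /andP[x0 xm]; apply/negP => /(H _ x0); lia.
have [->|[A /XP[m [m0 fE] _]]] := set_0Vmem X.
  by rewrite cards0 expr0n /= !mulr_ge0 ?exprn_ge0 //; lra.
apply: (@card_multiplicity_sq R f m d X m0 fE) => B /XP[m' [_ fE'] H].
by have -> : m = m' by lia.
Qed.

(** * The bijection between Frobenius numbers f and f + 2 *)

Section Stretch.
Variables f D : nat.
Hypotheses (f_gt0 : 0 < f) (Df : 3 * D <= f).
Local Notation c := (f - D).

(** Two shifts by 1 below the cut add up to the shift by 2 above it. The values missed are 1, which
    stays a gap, and [c.+1], the free position. *)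
Definition stretch (x : nat) : nat :=
  if x == 0 then 0 else if x < c then x.+1 else x.+2.

Variant stretch_spec (x : nat) : nat -> Prop :=
  | StretchZero of x = 0 : stretch_spec x 0
  | StretchLow of 0 < x & x < c : stretch_spec x x.+1
  | StretchHigh of 0 < x & c <= x : stretch_spec x x.+2.

Lemma stretchP x : stretch_spec x (stretch x).
Proof.
rewrite /stretch; case: eqVneq => [->|]; first exact: StretchZero.
by rewrite -lt0n => x0; case: ltnP => xc; [apply: StretchLow|apply: StretchHigh].
Qed.

Lemma stretch_inj : injective stretch.
Proof.
by move=> x y; case: (stretchP x); case: (stretchP y); lia.
Qed.

Lemma stretch_cases y : [\/ y = 1, y = c.+1 | exists x, y = stretch x].
Proof.
have [->|y0] := eqVneq y 0; first by apply: Or33; exists 0.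
have [->|y1] := eqVneq y 1; first exact: Or31.
have [->|yc] := eqVneq y c.+1; first exact: Or32.
apply: Or33; have [h|h] := leqP y c.
  by exists y.-1; case: stretchP; lia.
by exists y.-2; case: stretchP; lia.
Qed.

Lemma stretch_le x : (stretch x <= f.+2) = (x <= f).
Proof. by case: stretchP; lia. Qed.

Lemma stretch_neq x : (stretch x != 1) && (stretch x != c.+1).
Proof. by case: stretchP; lia. Qed.

Definition stretch_ord (x : 'I_f.+1) : 'I_f.+3 := inord (stretch x).

Lemma val_stretch_ord x : stretch_ord x = stretch x :> nat.
Proof. by rewrite inordK // ltnS stretch_le -ltnS. Qed.

Lemma stretch_ord_inj : injective stretch_ord.
Proof.
by move=> x y /(congr1 val) /=; rewrite !val_stretch_ord => /stretch_inj /val_inj.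
Qed.

Let c_ord : 'I_f.+3 := inord c.+1.

Let val_c_ord : c_ord = c.+1 :> nat.
Proof. by rewrite inordK //; lia. Qed.

Let c_ord_notin (A : {set 'I_f.+1}) : c_ord \notin stretch_ord @: A.
Proof.
apply/negP => /imsetP[x _ /(congr1 val)] /=; rewrite val_stretch_ord val_c_ord => h.
by have := stretch_neq x; rewrite -h eqxx andbF.
Qed.

Definition extend (p : {set 'I_f.+1} * bool) : {set 'I_f.+3} :=
  stretch_ord @: p.1 :|: (if p.2 then [set c_ord] else finset.set0).

Definition restrict (B : {set 'I_f.+3}) : {set 'I_f.+1} * bool :=
  (stretch_ord @^-1: B, c_ord \in B).

Lemma card_extend p : #|extend p| = (#|p.1| + p.2)%N.
Proof.
case: p => A e /=; rewrite /extend /= cardsU (card_imset _ stretch_ord_inj).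
case: e => /=; last by rewrite finset.setI0 !cards0 subn0.
rewrite cards1 (_ : _ :&: _ = finset.set0) ?cards0 ?subn0 //.
apply/setP => x; rewrite !inE; apply/negP => /andP[xA /eqP xc].
by have := c_ord_notin A; rewrite -xc xA.
Qed.

Lemma extend_stretch p x : (stretch_ord x \in extend p) = (x \in p.1).
Proof.
rewrite inE mem_imset; last exact: stretch_ord_inj.
case: p.2; rewrite ?inE ?orbF //.
case: eqP; rewrite ?orbF // => /(congr1 val) /=; rewrite val_stretch_ord val_c_ord => h.
by have := stretch_neq x; rewrite h eqxx andbF.
Qed.

Lemma extend_c p : (c_ord \in extend p) = p.2.
Proof. by rewrite inE (negbTE (c_ord_notin _)) /=; case: p.2; rewrite !inE ?eqxx. Qed.

Lemma extendK : cancel extend restrict.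
Proof.
move=> p; rewrite /restrict extend_c; case: p => A e /=; congr pair.
by apply/setP => x; rewrite inE extend_stretch.
Qed.

Lemma restrictK (B : {set 'I_f.+3}) : ~~ lamb B 1 -> extend (restrict B) = B.
Proof.
move=> B1; apply/setP => y; have [y1|yc|[x yx]] := stretch_cases y.
- have -> : (y \in B) = false by rewrite -lamb_ord y1; apply/negbTE.
  apply/negP; rewrite inE => /orP[/imsetP[x _ /(congr1 val)]|].
    by rewrite /= val_stretch_ord y1 => h; have := stretch_neq x; rewrite -h eqxx.
  case: ifP => _; rewrite !inE // => /eqP /(congr1 val) /=.
  by rewrite val_c_ord y1; lia.
- by have -> : y = c_ord; [apply: val_inj; rewrite /= val_c_ord|rewrite extend_c].
- have xf : x < f.+1 by rewrite ltnS -stretch_le -yx -ltnS.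
  have -> : y = stretch_ord (Ordinal xf) by apply: val_inj; rewrite [RHS]val_stretch_ord.
  by rewrite extend_stretch inE.
Qed.

Lemma lamb_extend p x : lamb (extend p) (stretch x) = lamb p.1 x.
Proof.
have [fx|xf] := ltnP f x.
  by rewrite !lamb_gt // ltnNge stretch_le -ltnNge.
rewrite /lamb stretch_le xf /=.
have -> : inord (stretch x) = stretch_ord (inord x).
  by rewrite /stretch_ord inordK.
exact: extend_stretch.
Qed.

Lemma lamb_extend1 p : lamb (extend p) 1 = false.
Proof.
rewrite /lamb /=; apply/negP; rewrite inE => /orP[/imsetP[x _ /(congr1 val)]|].
  rewrite /= val_stretch_ord inordK // => h.
  by have := stretch_neq x; rewrite -h eqxx.
case: ifP => _; rewrite !inE // => /eqP /(congr1 val) /=.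
by rewrite val_c_ord inordK //; lia.
Qed.

(* As [f >= 3 D], two positive elements whose sum is at most [f] both lie below the
   cut [c] and their sum lies above it, so stretching at [c] preserves addition. *)
Lemma extend_NSFD p : (extend p \in NSFD f.+2 D) = (p.1 \in NSFD f D).
Proof.
set B := extend p; set A := p.1.
have AB x : lamb A x = lamb B (stretch x) by rewrite lamb_extend.
apply/NSFDP/NSFDP => -[/NSFP[L0 LD Lf] LM].
  have AM x : 0 < x -> lamb A x -> f < 2 * x + D.
    move=> x0; rewrite AB => /LM.
    by case: stretchP; lia.
  split => //; apply/NSFP; split.
  - by rewrite AB.
  - move=> x y Ax Ay.
    have [->|x0] := posnP x; first by [].
    have [->|y0] := posnP y; first by rewrite addn0.
    have [fxy|xyf] := ltnP f (x + y); first exact: lamb_gt.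
    have := AM _ x0 Ax; have := AM _ y0 Ay => hy hx.
    rewrite AB (_ : stretch _ = stretch x + stretch y); first by apply: LD; rewrite -AB.
    by case: (stretchP x); case: (stretchP y); case: stretchP; lia.
  - rewrite AB (_ : stretch f = f.+2) //.
    by case: stretchP; lia.
have BM y : 0 < y -> lamb B y -> f.+2 < 2 * y + D.
  move=> y0; have [->|->|[x yx]] := stretch_cases y.
  - by rewrite lamb_extend1.
  - by move=> _; lia.
  - rewrite yx -AB => Ax; have [x0|x0] := posnP x; first by move: y0; rewrite yx x0.
    have := LM _ x0 Ax.
    by case: stretchP; lia.
split => //; apply/NSFP; split.
- by rewrite -[0]/(stretch 0) -AB.
- move=> x y Bx By.
  have [->|x0] := posnP x; first by [].
  have [->|y0] := posnP y; first by rewrite addn0.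
  have [fxy|xyf] := ltnP f.+2 (x + y); first exact: lamb_gt.
  have := BM _ x0 Bx; have := BM _ y0 By => hy hx.
  (* With [3 * D <= f], the bounds [hx], [hy] and [xyf] force [x] and [y] into [[2, c]], so the free
     position takes part in no sum. *)
  have xE : x = stretch x.-1.
    by case: stretchP; lia.
  have yE : y = stretch y.-1.
    by case: stretchP; lia.
  rewrite (_ : x + y = stretch (x.-1 + y.-1)); first by rewrite -AB LD ?AB -?xE -?yE.
  by case: stretchP; lia.
- have sf : stretch f = f.+2 by case: stretchP; lia.
  by move: Lf; rewrite AB sf.
Qed.

(** Reindexing along [extend]: the free position is either filled or left as a gap. Dependence on
    [#|B|] alone is enough for the genus, by [genus_frobE]. *)
Lemma sum_NSFDSS (V : nmodType) (W : nat -> V) :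
  (\sum_(B in NSFD f.+2 D) W #|B| =
   \sum_(A in NSFD f D) (W #|A|.+1 + W #|A|))%R.
Proof.
rewrite (reindex_onto extend restrict) /=; last first.
  move=> B /NSFDP[_ BM]; apply: restrictK.
  by apply/negP => /BM; lia.
rewrite (eq_bigl (fun p => (p.1 \in NSFD f D) && true)); last first.
  by move=> p; rewrite extendK eqxx extend_NSFD.
rewrite -(pair_big (fun A => A \in NSFD f D) (fun=> true)
   (fun A e => W #|extend (A, e)|)) /=.
by apply: eq_bigr => A _; rewrite big_bool !card_extend /= addn1 addn0.
Qed.

End Stretch.

(** Witness: 0 together with all integers above [f]. *)
Lemma NSFD0_neq0 f : 0 < f -> NSFD f 0 != finset.set0.
Proof.
move=> f0; apply/set0Pn; exists [set ord0]%SET.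
have lambE x : lamb [set (ord0 : 'I_f.+1)]%SET x = (x == 0) || (f < x).
  have [fx|xf] := ltnP f x; first by rewrite lamb_gt // orbT.
  rewrite /lamb xf orbF /= inE; apply/eqP/eqP => [/(congr1 val)|->].
    by rewrite /= inordK.
  by apply: val_inj; rewrite /= inordK.
apply/NSFDP; split; last by move=> x x0; rewrite lambE; lia.
by apply/NSFP; split; [rewrite lambE|move=> x y|]; rewrite ?lambE; lia.
Qed.

Lemma genus_frobE f (A : {set 'I_f.+1}) :
  (genus_frob f (lam A) + #|A|)%N = f.+1.
Proof.
rewrite /genus_frob -val_enum_ord count_map -[RHS](card_ord f.+1) -(cardC A) addnC.
congr (_ + _); rewrite cardE [in RHS]/enum_mem size_filter -enumT /=.
apply: eq_count => x /=; rewrite inE -lamb_ord.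
by congr (~~ _); apply/asboolP/lambP.
Qed.

(** * Convergence of the normalised sums *)

Section Limit.
Variables (R : realType) (p : nat) (W : nat -> nat -> R).
Local Open Scope ring_scope.
Hypothesis W_split : forall f n, W f.+2 n.+1 + W f.+2 n = 2 * W f n.

Definition layer (D k : nat) : R :=
  (\sum_(A in NSFD (2 * k + p) D) W (2 * k + p) #|A|) / 2 ^+ k.

Lemma layerS D k : (0 < 2 * k + p)%N -> (3 * D <= 2 * k + p)%N ->
  layer D k.+1 = layer D k.
Proof.
move=> f0 fD; rewrite /layer (_ : 2 * k.+1 + p = (2 * k + p).+2)%N; last by lia.
rewrite (sum_NSFDSS f0 fD (W (2 * k + p).+2)).
under eq_bigr do rewrite W_split.
by rewrite -big_distrr /= exprS invfM mulrACA divff ?mul1r.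
Qed.

Lemma layer_const D j k : (0 < 2 * j + p)%N -> (3 * D <= 2 * j + p)%N -> (j <= k)%N ->
  layer D k = layer D j.
Proof.
move=> j0 jD; elim: k => [|k IH]; first by rewrite leqn0 => /eqP ->.
rewrite leq_eqVlt => /orP[/eqP <- //|]; rewrite ltnS => jk.
by rewrite layerS ?IH //; lia.
Qed.

Hypothesis p_le1 : (p <= 1)%N.

(** Square root of [card_NSFDS_sq]: 97/100 <= (99/100)^2, and the factor 2 absorbs [2 ^+ p]. *)
Lemma card_NSFDS k d : (#|NSFD (2 * k + p) d.+1 :\: NSFD (2 * k + p) d|)%:R <=
  2 * d.+1%:R * (99/100) ^+ d * 2 ^+ k :> R.
Proof.
have c0 : 0 <= (99/100) ^+ d :> R by rewrite exprn_ge0 //; lra.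
have d0 : 0 <= d.+1%:R :> R by [].
have k0 : 0 <= 2 ^+ k :> R by rewrite exprn_ge0.
rewrite -(@ler_pXn2r _ 2) ?nnegrE ?mulr_ge0 //.
apply: le_trans (card_NSFDS_sq R _ _) _.
rewrite exprD [(2 * k)%N]mulnC exprM.
have h1 : (97/100) ^+ d <= ((99/100) ^+ 2) ^+ d :> R.
  by apply: lerXn2r; rewrite ?nnegrE; lra.
have h2 : 2 ^+ p <= 2 ^+ 2 :> R by rewrite ler_eXn2l ?ltr1n //; lia.
rewrite [leRHS](_ : _ = d.+1%:R ^+ 2 * ((99 / 100) ^+ 2) ^+ d *
  ((2 ^+ k) ^+ 2 * 2 ^+ 2)); last first.
  by rewrite [((99 / 100) ^+ 2) ^+ d]exprAC; ring.
have h0 : 0 <= (97/100) ^+ d :> R by rewrite exprn_ge0 //; lra.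
apply: ler_pM; rewrite ?(mulr_ge0 _ h0) ?mulr_ge0 ?exprn_ge0 //.
  by rewrite ler_wpM2l ?exprn_ge0.
by rewrite ler_wpM2l ?exprn_ge0.
Qed.

(** The base satisfies (251/250)^2 * 99/100 <= 499/500, so the square of a linear factor can be
    absorbed into the geometric decay. *)
Lemma linear_le_exp (d : nat) : d.+1%:R <= 250 * (251/250) ^+ d :> R.
Proof.
elim: d => [|d IH]; first by rewrite expr0; lra.
have h : 1 <= (251/250) ^+ d :> R by rewrite exprn_ege1 //; lra.
by rewrite exprS -natr1; lra.
Qed.

Hypothesis W_bound : forall f n, (n <= f.+1)%N -> `|W f n| <= f.+1%:R.

Lemma layer_diff_small d k : (2 * k + p <= 3 * d + 4)%N ->
  `|layer d.+1 k - layer d k| <= 10 * 250 ^+ 2 * (499/500) ^+ d.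
Proof.
move=> kd; have k0 : 0 < 2 ^+ k :> R by rewrite exprn_gt0.
rewrite /layer -mulrBl normrM normfV (gtr0_norm k0).
rewrite ler_pdivrMr // (big_setID (NSFD (2 * k + p) d)) /=.
rewrite (finset.setIidPr (NSFD_sub _ _)) addrAC subrr add0r.
set X := _ :\: _; set f := (2 * k + p)%N.
apply: (@le_trans _ _ (f.+1%:R * (#|X|)%:R)).
  apply: le_trans (ler_norm_sum _ _ _) _.
  rewrite mulr_natr -sumr_const; apply: ler_sum => A _; apply: W_bound.
  by rewrite -[leqRHS]card_ord max_card.
have f5 : f.+1%:R <= 5 * d.+1%:R :> R by rewrite -natrM ler_nat; lia.
have c0 : 0 <= (99/100) ^+ d :> R by rewrite exprn_ge0 //; lra.
apply: (@le_trans _ _ (5 * d.+1%:R * (2 * d.+1%:R * (99/100) ^+ d * 2 ^+ k))).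
  by apply: ler_pM => //; exact: card_NSFDS.
rewrite [leLHS](_ : _ = 10 * (d.+1%:R ^+ 2 * (99/100) ^+ d) * 2 ^+ k); last by ring.
rewrite (ler_pM2r k0) -[leRHS]mulrA ler_wpM2l ?ler0n //.
apply: (@le_trans _ _ ((250 * (251/250) ^+ d) ^+ 2 * (99/100) ^+ d)).
  have h : 0 <= 250 * (251/250) ^+ d :> R by apply: mulr_ge0; [exact: ler0n|apply: exprn_ge0; lra].
  by rewrite ler_wpM2r // lerXn2r ?nnegrE ?linear_le_exp.
have h250 : 0 <= 250 ^+ 2 :> R by rewrite exprn_ge0 ?ler0n.
rewrite exprMn -mulrA (ler_wpM2l h250) // exprAC -exprMn.
by apply: lerXn2r; rewrite ?nnegrE; lra.
Qed.

(** Once [3 * d.+1 <= 2 * k + p], both layers are stationary in [k], so the bound propagates from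
    the range of [layer_diff_small]. *)
Lemma layer_diff : exists2 C : R, 0 <= C &
  forall d k, `|layer d.+1 k - layer d k| <= C * (499/500) ^+ d.
Proof.
exists (10 * 250 ^+ 2) => [|d k]; first by rewrite mulr_ge0 ?exprn_ge0 ?ler0n.
elim: k => [|k IH]; first by apply: layer_diff_small; lia.
have [h|h] := leqP (2 * k.+1 + p) (3 * d + 4); first exact: layer_diff_small.
by rewrite !layerS //; lia.
Qed.

(** Telescoping; 500 is 1 / (1 - 499/500). *)
Lemma layer_tail C D i k :
  (forall d, `|layer d.+1 k - layer d k| <= C * (499/500) ^+ d) ->
  `|layer (D + i) k - layer D k| <= 500 * C * ((499/500) ^+ D - (499/500) ^+ (D + i)).
Proof.
move=> diff; elim: i => [|i IH]; first by rewrite addn0 !subrr normr0 mulr0.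
rewrite addnS; have := diff (D + i)%N => h.
rewrite -[_ - _](subrKA (layer (D + i) k)).
by apply: le_trans (ler_normD _ _) _; rewrite exprS; lra.
Qed.

Lemma is_cvg_layer_full :
  cvg ((fun k : nat => layer (2 * k + p).+1 k) @ \oo)%classic.
Proof.
apply: R_complete; apply: cauchy_exP => e e0.
have [C C0 diff] := layer_diff.
have : ((geometric (500 * C) (499/500)) @ \oo --> (0 : R))%classic.
  by apply: cvg_geometric; rewrite ger0_norm; lra.
move/cvgrPdist_lt => /(_ _ e0)[D _ /(_ D (leqnn _))] /=.
rewrite sub0r normrN => /(le_lt_trans (ler_norm _)) De.
 (* The ball is centred at the eventual value of [layer D], reached by [k = (3 * D).+1]. *)
 exists (layer D (3 * D).+1); exists (3 * D).+1 => // k /= Dk; rewrite -ball_normE /=.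
rewrite -(@layer_const D _ k _ _ Dk); [|lia|lia].
rewrite distrC -(@subnKC D (2 * k + p).+1); last by lia.
apply: le_lt_trans (layer_tail _ _ (fun d => diff d k)) _.
apply: le_lt_trans De.
have h : 0 <= (499/500) ^+ (D + ((2 * k + p).+1 - D)) :> R.
  by apply: exprn_ge0; lra.
by apply: ler_wpM2l; [exact: mulr_ge0 (ler0n _ _) C0|rewrite gerBl].
Qed.

End Limit.

(** * Expected genus along one parity *)

Section Parity.
Variables (R : realType) (p : nat).
Hypothesis p_le1 : (p <= 1)%N.
Local Open Scope ring_scope.
Local Open Scope classical_set_scope.

Let W0 (f n : nat) : R := 1.
Let W1 (f n : nat) : R := f.+1%:R - n%:R - 3 * f%:R / 4.

Let W0_split f n : W0 f.+2 n.+1 + W0 f.+2 n = 2 * W0 f n.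
Proof. by rewrite /W0; lra. Qed.

Let W0_bound f n : (n <= f.+1)%N -> `|W0 f n| <= f.+1%:R.
Proof. by move=> _; rewrite /W0 normr1 ler1n. Qed.

(** Position 1 always adds a gap and the free position adds one in half of the extensions: 3/2 on
    average while f grows by 2, which is the origin of 3/4. *)
Let W1_split f n : W1 f.+2 n.+1 + W1 f.+2 n = 2 * W1 f n.
Proof.
by rewrite /W1 -[f.+3%:R]natr1 -[f.+2%:R]natr1 -[f.+1%:R]natr1 -[n.+1%:R]natr1; lra.
Qed.

Let W1_bound f n : (n <= f.+1)%N -> `|W1 f n| <= f.+1%:R.
Proof.
rewrite -(ler_nat R) /W1 -[f.+1%:R]natr1 => h; have f0 : 0 <= f%:R :> R by [].
have n0 : 0 <= n%:R :> R by [].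
by rewrite ler_norml; apply/andP; split; lra.
Qed.

Let total k := layer p W0 (2 * k + p).+1 k.
Let excess k := layer p W1 (2 * k + p).+1 k.

(** The layer for [D = 0] is constant from [k = 1] on and bounds the full count from below, so the
    limit of [total] is nonzero. *)
Lemma total_ge k : (0 < k)%N -> layer p W0 0 1 <= total k.
Proof.
move=> k0; rewrite -(@layer_const _ p W0 W0_split 0 1 k) //.
rewrite /total /layer ler_wpM2r ?invr_ge0 ?exprn_ge0 //.
rewrite !sumr_const ler_nat subset_leq_card //.
by rewrite NSFD_full; apply/fintype.subsetP => A /NSFDP[].
Qed.

Lemma layer0_gt0 : 0 < layer p W0 0 1.
Proof.
rewrite /layer divr_gt0 // sumr_const ltr0n card_gt0 NSFD0_neq0 //; lia.
Qed.

Lemma expected_genus_ratio k : (0 < k)%N ->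
  expected_genus R (2 * k + p) - 3 * (2 * k + p)%:R / 4 = excess k / total k.
Proof.
move=> k0; have Tk := lt_le_trans layer0_gt0 (total_ge k0).
move: Tk; rewrite /excess /total /layer NSFD_full sumr_const /W1.
set f := (2 * k + p)%N; set P := (2 ^+ k : R) => Tk.
have P0 : P != 0 by rewrite expf_neq0.
have N0 : (#|NSF f|)%:R != 0 :> R.
  by apply: contraTneq Tk => ->; rewrite mul0r ltxx.
have -> : \sum_(A in NSF f) (f.+1%:R - #|A|%:R - 3 * f%:R / 4) =
    \sum_(A in NSF f) (genus_frob f (lam A))%:R - 3 * f%:R / 4 * (#|NSF f|)%:R :> R.
  rewrite sumrB sumr_const [_ * #|NSF f|%:R]mulr_natr; congr (_ - _); apply: eq_bigr => A _.
  by rewrite -[in f.+1%:R](genus_frobE A) natrD addrK.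
rewrite /expected_genus.
by field; rewrite P0 N0.
Qed.

Lemma cvg_expected_genus : exists gamma : R,
  (fun k : nat => expected_genus R (2 * k + p) - 3 * (2 * k + p)%:R / 4)
    @ \oo --> gamma.
Proof.
have cT : cvg (total @ \oo) := is_cvg_layer_full W0_split p_le1 W0_bound.
have cE : cvg (excess @ \oo) := is_cvg_layer_full W1_split p_le1 W1_bound.
have T0 : lim (total @ \oo) != 0.
  rewrite gt_eqF //; apply: lt_le_trans layer0_gt0 _.
  by apply: limr_ge => //; exists 1%N => // k /= /total_ge.
exists (lim (excess @ \oo) / lim (total @ \oo)).
apply: cvg_trans (cvgM cE (cvgV T0 cT)).
by apply: near_eq_cvg; exists 1%N => // k /= /expected_genus_ratio ->.
Qed.

End Parity.

Local Open Scope classical_set_scope.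
Local Open Scope ring_scope.

Theorem theorem5p6 (R : realType) :
  exists gamma0 gamma1 : R,
    (fun k : nat => expected_genus R (2 * k)%N - 3 * (2 * k)%N%:R / 4)
      @ \oo --> gamma0 /\
    (fun k : nat => expected_genus R (2 * k).+1 - 3 * (2 * k).+1%:R / 4)
      @ \oo --> gamma1.
Proof.
have [g0 h0] := @cvg_expected_genus R 0 isT.
have [g1 h1] := @cvg_expected_genus R 1 isT.
exists g0, g1; split.
  by under eq_fun do rewrite -[(2 * _)%N]addn0.
by under eq_fun do rewrite -addn1.
Qed.
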